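(* Let $n\ge 1$ and let $G\subset \mathrm{Diff}(\mathbb{C}^n,0)$ be a finitely generated pseudogroup on a small neighborhood of the origin in $\mathbb{C}^n$. Suppose that for every $g\in G$ and every $p\in \mathrm{Dom}(g)$ satisfying $g(p)=p$, one of the following holds: either $p$ is an isolated fixed point of $g$, or $g$ coincides with the identity on a neighborhood of $p$. Then the pseudogroup $G$ has finite orbits on a neighborhood of the origin if and only if $G$ itself is finite.
   Context: $\mathrm{Diff}(\mathbb{C}^n,0)$ is the group of germs of local holomorphic diffeomorphisms of $\mathbb{C}^n$ fixing the origin. Pseudogroup: given $h_1,\dots,h_k\in \mathrm{Diff}(\mathbb{C}^n,0)$, choose representatives and a small open neighborhood $V$ of $0$ on which $h_1^{\pm1},\dots,h_k^{\pm1}$ are defined and one-to-one. The pseudogroup $G$ generated by $h_1,\dots,h_k$ on $V$ consists of the maps $F=F_s\circ\cdots\circ F_1$ with each $F_i\in\{h_1^{\pm1},\dots,h_k^{\pm1}\}$, where the domain of definition $\mathrm{Dom}(F)=\mathrm{Dom}_V(F)$ is the set of $x\in V$ such that $F_l\circ\cdots\circ F_1(x)\in V$ for every $1\le l<s$. The same letter $G$ denotes the group of germs at $0$ generated by $h_1,\dots,h_k$. The orbit of $p\in V$ is $\mathcal{O}_V^G(p)=\{h(p) \in V: h\in G,\ p\in \mathrm{Dom}_V(h)\}$. The pseudogroup $G$ has finite orbits if there is a sufficiently small open neighborhood $V$ of $0$, on which $h_1^{\pm1},\dots,h_k^{\pm1}$ are well-defined injective maps, such that $\mathcal{O}_V^G(p)$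 is finite for every $p\in V$. ''$G$ is finite'' means that the group of germs at $0$ generated by $h_1,\dots,h_k$ is finite. *)

(* Defs.v *)
From HB Require Import structures.
From mathcomp Require Import all_boot all_order all_algebra.
From mathcomp Require Import complex.
From mathcomp Require Import all_classical all_reals all_analysis.

Set Implicit Arguments.
Unset Strict Implicit.
Unset Printing Implicit Defensive.

Import Order.TTheory GRing.Theory Num.Theory.
Import numFieldNormedType.Exports.

Local Open Scope classical_set_scope.
Local Open Scope ring_scope.
Local Open Scope complex_scope.

(* C^n with the sup norm, as a normed space over the complex field R[i];
   [differentiable] between such spaces is therefore complex (Frechet)
   differentiability. *)
Definition Cn (R : realType) (n : nat) : normedModType R[i] := 'rV[R[i]]_n.

Definition holomorphic_on (R : realType) (n : nat) (U : set (Cn R n))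
    (f : Cn R n -> Cn R n) : Prop :=
  open U /\ forall x, U x -> differentiable f x.

(* A representative of an element of Diff(C^n, 0): a biholomorphism from an open
   neighbourhood [ld_dom] of 0 onto its open image, fixing 0. The functions are
   total; the values of [ld_fun] outside [ld_dom], and of [ld_inv] outside the
   image, are irrelevant. *)
Record local_diffeo (R : realType) (n : nat) := LocalDiffeo {
  ld_dom : set (Cn R n);
  ld_fun : Cn R n -> Cn R n;
  ld_inv : Cn R n -> Cn R n;
  ld_dom0 : ld_dom 0;
  ld_fun0 : ld_fun 0 = 0;
  ld_fun_holo : holomorphic_on ld_dom ld_fun;
  ld_inv_holo : holomorphic_on (ld_fun @` ld_dom) ld_inv;
  ld_funK : forall x, ld_dom x -> ld_inv (ld_fun x) = x
}.

Section Pseudogroup.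
Context (R : realType) (n k : nat) (h : 'I_k -> local_diffeo R n).

(* V is an open neighbourhood of 0 on which all the h_i and h_i^-1 are defined
   (injectivity on V is then automatic). *)
Definition pseudogroup_domain (V : set (Cn R n)) : Prop :=
  [/\ open V, V 0 &
      forall i, V `<=` ld_dom (h i) `&` (ld_fun (h i) @` ld_dom (h i))].

(* (i, false) stands for h_i and (i, true) for h_i^-1. *)
Definition letter : Type := ('I_k * bool)%type.

Definition letter_map (a : letter) : Cn R n -> Cn R n :=
  if a.2 then ld_inv (h a.1) else ld_fun (h a.1).

(* An element of the pseudogroup is a composition F_s o ... o F_1, kept as the
   sequence [:: F_1; ...; F_s] since its domain depends on that decomposition;
   the empty composition is the identity, defined on all of V. *)
Definition word : Type := seq letter.

Definition word_map (w : word) (x : Cn R n) : Cn R n :=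
  foldl (fun y a => letter_map a y) x w.

(* The last value, for l = s, is not required to lie in V. *)
Definition Dom (V : set (Cn R n)) (w : word) : set (Cn R n) :=
  [set x | V x /\
    forall l : nat, (1 <= l < size w)%N -> V (word_map (take l w) x)].

Definition fixed_points (V : set (Cn R n)) (w : word) : set (Cn R n) :=
  [set x | Dom V w x /\ word_map w x = x].

Definition orbit (V : set (Cn R n)) (p : Cn R n) : set (Cn R n) :=
  [set q | V q /\ exists2 w : word, Dom V w p & q = word_map w p].

Definition has_finite_orbits : Prop :=
  exists V : set (Cn R n),
    pseudogroup_domain V /\ forall p, V p -> finite_set (orbit V p).

(* The germ of f at 0, as an equivalence class of maps. *)
Definition germ0 (f : Cn R n -> Cn R n) : set (Cn R n -> Cn R n) :=
  [set g | \forall x \near (0 : Cn R n), g x = f x].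

(* The underlying set of the subgroup of Diff(C^n, 0) generated by the germs of
   the h_i. All letters fix 0 and are continuous there, so these germs do not
   depend on the irrelevant values in [local_diffeo]. *)
Definition germ_group : set (set (Cn R n -> Cn R n)) :=
  range (fun w : word => germ0 (word_map w)).

End Pseudogroup.

(* Main.v *)
Require Import Defs.
From HB Require Import structures.
From mathcomp Require Import all_boot all_order all_algebra.
From mathcomp Require Import complex.
From mathcomp Require Import all_classical all_reals all_analysis.

Import Order.TTheory GRing.Theory Num.Theory.
Import numFieldNormedType.Exports.

Local Open Scope classical_set_scope.
Local Open Scope ring_scope.

(** Finite germ group implies finite orbits: pick finitely many words
    representing all germs.  Close enough to 0, composing a representative with
    a letter gives another representative, so the orbit of a point is among the
    images of that point under the representatives ([finite_local_orbits]).

    Conversely, suppose that the orbits are finite and that there are infinitely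
    many germs.  A shortest word representing its germ contains no nonempty
    factor whose germ at 0 is the identity, so such words exist in every length
    ([germ_group_finite]).  For such a word w and a ball K of radius r, let B be
    the set of the x whose successive images under the prefixes of w all lie in
    K and along which no factor of w is the identity near the point where it
    acts ([itinerary]).  It contains 0.

    - B is compact.  By the dichotomy on fixed points, a fixed point of a factor
      at which that factor is not locally the identity is isolated, so that
      nearby points are not locally fixed either.  Hence, if the images of B
      stayed in the open ball, B would also be open: this is impossible in C^n.
      So some image of some point of B has norm r ([itinerary_boundary]), as in
      the lemma of Lewowicz on iterates near a fixed point.

    - The points of norm r obtained in this way from words of length m form a
      compact set, which decreases when m grows.  So some y of norm r is obtained
      for every m ([sphere_cycle_point]).

    - The m + 1 successive images that form this path through y are in the orbit
      of y, which is finite.  When m is at least its cardinality, two of them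
      coincide, which gives a fixed point of a factor that is not the identity
      nearby: an isolated one.  Hence y is the image under a word of such an
      isolated fixed point.

    - There are countably many words, and by compactness each has finitely many
      such fixed points ([isolated_cycles_finite]).  So the points y, and their
      norms, are countable; but every r in an interval ]0, r0] is such a norm
      ([never_id_bounded]).

    The argument is purely topological, and is carried out for a space
    exhausted near a base point by a continuous function N with compact
    sublevel sets, on which letters act by invertible continuous maps fixing
    the base point. *)

(** * The topology of C^n *)

(** Bundling R[i] as a [numFieldType] gives it its norm topology. *)
Definition complexField (R : realType) : numFieldType := R[i].

Lemma entry_le_mx_norm (K : numFieldType) m n (x : 'M[K]_(m, n)) i j :
  `|x i j| <= `|x|.
Proof.
rewrite [leRHS]mx_normE -[leLHS]nngE num_le.
exact: (le_bigmax _ (fun i => `|x i.1 i.2|%:nng) (i, j)).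
Qed.

Section Cn_topology.
Context {R : realType} {n : nat}.

Lemma normC_Re (z : R[i]) : `|z| = (complex.Re `|z|)%:C%C.
Proof. by rewrite normc_def. Qed.

(** The norm of C^n takes its values in R[i]; its real part is the same norm
    seen as a real number, whose set of values Lebesgue measure can test. *)
Definition cnorm (x : Cn R n) : R := complex.Re `|x|.

Lemma cnormE (x : Cn R n) : `|x| = (cnorm x)%:C%C.
Proof. by rewrite /cnorm RRe_real // realE normr_ge0. Qed.

Lemma cnorm0 : cnorm 0 = 0.
Proof. by rewrite /cnorm normr0. Qed.

Lemma pos_complexP {e : R[i]} : 0 < e -> exists2 r : R, 0 < r & e = r%:C%C.
Proof.
move=> e0; have eE : (complex.Re e)%:C%C = e by rewrite RRe_real // realE ltW.
by exists (complex.Re e) => //; rewrite -ltcR eE.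
Qed.

Local Notation C := (complexField R).

Lemma Re_continuous : continuous (@complex.Re R : C -> R).
Proof.
move=> z; apply/(@cvgrPdist_lt _ R^o _ (nbhs z) _ (@complex.Re R) (complex.Re z)) => e e0.
apply/nbhs_normP; exists e%:C%C; first by rewrite /= ltcR.
move=> t /=; rewrite normc_def ltcR -raddfB => /(le_lt_trans _); apply.
by rewrite -sqrtr_sqr ler_sqrt ?lerDl ?sqr_ge0 ?addr_ge0 ?sqr_ge0.
Qed.

Lemma cnorm_continuous : continuous cnorm.
Proof.
move=> x; apply: (continuous_comp (f := fun x : Cn R n => `|x| : C)).
  exact: norm_continuous.
exact: Re_continuous.
Qed.

Lemma complex_square_compact (r : R) :
  compact [set z : C | `|complex.Re z| <= r /\ `|complex.Im z| <= r].
Proof.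
have -> : [set z : C | `|complex.Re z| <= r /\ `|complex.Im z| <= r] =
    (fun p : R * R => (p.1 +i* p.2)%C) @`
      (`[-r, r]%classic `*` `[-r, r]%classic).
  apply/seteqP; split=> [[a b] /=|_ [[a b] /= + <-]].
    by rewrite !ler_norml => -[ha hb]; exists (a, b) => //=; rewrite !in_itv.
  by rewrite !in_itv /= !ler_norml.
apply: continuous_compact; last by apply: compact_setX; exact: segment_compact.
apply: continuous_subspaceT => -[a b].
apply/cvgrPdist_lt => e /pos_complexP[d d0 ->].
have d20 : 0 < d / 2 by rewrite divr_gt0.
have na : \forall t \near (a, b), `|a - t.1| < d / 2.
  exact: (@cvgr_dist_lt _ R^o _ (nbhs (a, b)) _ fst a cvg_fst).
have nb : \forall t \near (a, b), `|b - t.2| < d / 2.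
  exact: (@cvgr_dist_lt _ R^o _ (nbhs (a, b)) _ snd b cvg_snd).
near=> t.
have -> : ((a, b).1 +i* (a, b).2)%C - (t.1 +i* t.2)%C =
  (a - t.1)%:C%C + 'i%C * (b - t.2)%:C%C.
  by apply/eqP; rewrite eq_complex /= !mul0r !mul1r !(add0r, addr0, subr0, mulr0) !eqxx.
rewrite (le_lt_trans (ler_normD _ _)) // normrM.
have -> : `|'i%C : C| = 1 by rewrite normc_def /= expr0n expr1n add0r sqrtr1.
rewrite mul1r !normc_def /= !expr0n !addr0 !sqrtr_sqr -rmorphD /= ltcR (splitr d).
by rewrite ltrD //; near: t.
Unshelve. all: by end_near. Qed.

Lemma Re_Im_le_norm (z : C) : `|complex.Re z| <= complex.Re `|z| /\ `|complex.Im z| <= complex.Re `|z|.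
Proof.
by rewrite normc_def /= -!sqrtr_sqr !ler_sqrt ?addr_ge0 ?sqr_ge0 ?lerDl ?lerDr ?sqr_ge0.
Qed.

Lemma coord_cnorm (x : Cn R n) j : complex.Re `|(x : 'rV[C]_n) ord0 j| <= cnorm x.
Proof.
rewrite -lecR -normC_Re -cnormE.
exact: (@entry_le_mx_norm C).
Qed.

Lemma cball_compact (r : R) : compact [set x : Cn R n | cnorm x <= r].
Proof.
apply: (@subclosed_compact _ _ [set v : 'rV[C]_n | forall j,
   [set z : C | `|complex.Re z| <= r /\ `|complex.Im z| <= r] (v ord0 j)]).
- apply: (@preimage_closed _ _ cnorm [set y | y <= r]); last exact: closed_le.
  by move=> x _; exact: cnorm_continuous.
- by apply: (@rV_compact C n (fun=> _)) => j; exact: complex_square_compact.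
- move=> x /= xr j; have [h1 h2] := Re_Im_le_norm ((x : 'rV[C]_n) ord0 j).
  have hx := le_trans (coord_cnorm x j) xr.
  by split; [exact: le_trans h1 hx|exact: le_trans h2 hx].
Qed.

Lemma nbhs0_cball (W : set (Cn R n)) : nbhs 0 W ->
  exists2 r : R, 0 < r & [set x : Cn R n | cnorm x <= r] `<=` W.
Proof.
move=> /nbhs_normP[e /= /pos_complexP[r r0 ->]] sub.
exists (r / 2); first by rewrite divr_gt0.
move=> x /= xr; apply: sub => /=; rewrite sub0r normrN cnormE ltcR.
by rewrite (le_lt_trans xr) // gtr_pMr // invf_lt1 // ltr1n.
Qed.

(** The real part of the first coordinate reaches its maximum on a nonempty
    compact set, and has no local maximum on an open one. *)
Lemma compact_not_open (B : set (Cn R n)) : (0 < n)%N ->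
  compact B -> open B -> B = set0.
Proof.
move=> n0 cB oB; apply/eqP/negPn/negP => /set0P B0.
pose j : 'I_n := Ordinal n0.
pose f (x : Cn R n) : R := complex.Re ((x : 'rV[C]_n) ord0 j).
have cf : continuous f.
  move=> x; apply: (continuous_comp (f := fun x : Cn R n => (x : 'rV[C]_n) ord0 j)).
    exact: coord_continuous.
  exact: Re_continuous.
have [c /set_mem Bc cmax] := compact_EVT_max B0 cB (continuous_subspaceT cf).
pose g (t : C) : Cn R n := c + t *: const_mx 1.
have cg : continuous g.
  move=> t; apply: (@cvgD C (Cn R n) C (nbhs t) _ _ _ _ _ (@cvg_cst _ _ _ _ _)).
  exact: (@scalel_continuous C (Cn R n) (const_mx 1) t).
have /nbhs_normP[_ /= /pos_complexP[r r0 ->] sub] : nbhs (0 : C) (g @^-1` B).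
  apply: cg; rewrite /g scale0r addr0; exact: open_nbhs_nbhs (conj oB Bc).
suff : f (g (r / 2)%:C%C) <= f c.
  by apply/negP; rewrite -ltNge /f !mxE mulr1 raddfD /= ltrDl divr_gt0.
apply: cmax; apply/mem_set/sub => /=.
rewrite sub0r normrN normc_def /= expr0n addr0 sqrtr_sqr ltcR.
by rewrite gtr0_norm ?divr_gt0 // gtr_pMr // invf_lt1 // ltr1n.
Qed.
End Cn_topology.

(** * Words acting near a base point *)

Lemma near_preimage {S T : topologicalType} {g : S -> T} {x : S} {P : set T} :
  {for x, continuous g} -> (\forall z \near g x, P z) ->
  \forall y \near x, P (g y).
Proof. by move=> cg /cg. Qed.

Section Words.
Set Implicit Arguments.
Unset Strict Implicit.
Context {R : realType} {T : ptopologicalType} {A : finType}.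
Variables (f : A -> T -> T) (N : T -> R).

Definition act (w : seq A) (x : T) : T := foldl (fun y a => f a y) x w.

Definition id_near (v : seq A) (x : T) : Prop := \forall y \near x, act v y = y.

Definition stays (r : R) (w : seq A) : set T :=
  [set x | forall u t, w = u ++ t -> N (act u x) <= r].

(** At the base point, which all letters fix, this says that no nonempty factor of
    [w] has a trivial germ, as is the case of a shortest word for its germ.  At
    other points, it makes the revisits of an itinerary isolated. *)
Definition never_id (w : seq A) : set T :=
  [set x | forall u v t, w = u ++ v ++ t -> v <> [::] -> ~ id_near v (act u x)].

Definition itinerary (r : R) (w : seq A) : set T := stays r w `&` never_id w.

Lemma act_cat u v x : act (u ++ v) x = act v (act u x).
Proof. by rewrite /act foldl_cat. Qed.

Lemma stays_le r s w : r <= s -> stays r w `<=` stays s w.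
Proof. by move=> rs x xw u t wE; exact: le_trans (xw u t wE) rs. Qed.

Lemma stays_N r w x : stays r w x -> N x <= r.
Proof. by move=> /(_ [::] w erefl). Qed.

Lemma stays_catl r u t : stays r (u ++ t) `<=` stays r u.
Proof. by move=> x xw u' t' uE; apply: (xw u' (t' ++ t)); rewrite uE catA. Qed.

Lemma stays_catr r u t x : stays r (u ++ t) x -> stays r t (act u x).
Proof.
move=> xw u' t' tE; rewrite -act_cat; apply: (xw _ t').
by rewrite tE catA.
Qed.

Lemma stays_consP r a w x :
  stays r (a :: w) x <-> N x <= r /\ stays r w (f a x).
Proof.
split=> [xw|[xr xw] [|b u] t //= [<- wE]]; last exact: xw wE.
by split; [exact: stays_N xw|exact: (@stays_catr r [:: a])].
Qed.

Lemma never_id_catl u t : never_id (u ++ t) `<=` never_id u.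
Proof.
by move=> x xw u' v t' uE; apply: (xw u' v (t' ++ t)); rewrite uE !catA.
Qed.

Lemma never_id_catr u t x : never_id (u ++ t) x -> never_id t (act u x).
Proof.
move=> xw u' v t' tE; rewrite -act_cat; apply: (xw _ _ t').
by rewrite tE !catA.
Qed.

Lemma itinerary_catl r u t : itinerary r (u ++ t) `<=` itinerary r u.
Proof. by move=> x [/stays_catl ? /never_id_catl]. Qed.

Lemma itinerary_catr r u t x :
  itinerary r (u ++ t) x -> itinerary r t (act u x).
Proof. by move=> [/stays_catr ? /never_id_catr]. Qed.

(** Reduces factorizations of a word to finitely many, so that properties which
    hold near a point for each of them hold near it for all of them. *)
Lemma factorization_ind (P : seq A -> seq A -> Prop) (w : seq A) :
  (forall i j : 'I_(size w).+1, P (take i w) (take j (drop i w))) ->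
  forall u v t, w = u ++ v ++ t -> P u v.
Proof.
move=> Pw u v t wE.
have su : (size u < (size w).+1)%N by rewrite wE size_cat ltnS leq_addr.
have sv : (size v < (size w).+1)%N.
  by rewrite wE !size_cat ltnS addnCA leq_addr.
have := Pw (Ordinal su) (Ordinal sv).
by rewrite /= wE take_size_cat // drop_size_cat // take_size_cat.
Qed.

(** ** Compactness of itineraries *)

Section Exhaustion.
Variable r0 : R.
Hypothesis T_hausdorff : hausdorff_space T.
Hypothesis N_continuous : continuous N.
Hypothesis N_compact : compact [set x | N x <= r0].
Hypothesis f_continuous : forall a x, N x <= r0 -> {for x, continuous (f a)}.

Lemma stays_continuous r w x : r <= r0 ->
  stays r w x -> {for x, continuous (act w)}.
Proof.
move=> rr0; elim: w x => [|a w IH] x; first by move=> _; exact: cvg_id.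
move=> /stays_consP[xr /IH cw].
exact: (continuous_comp (f_continuous (a := a) (le_trans xr rr0)) cw).
Qed.

Lemma stays_closed r w : r <= r0 -> closed (stays r w).
Proof.
move=> rr0; have cK : closed [set x | N x <= r].
  apply: (@preimage_closed _ _ N [set y | y <= r]); last exact: closed_le.
  by move=> x _; exact: N_continuous.
elim: w => [|a w IH] x cx.
  move=> [|//] [|//] _; apply: cK; apply: closureS cx.
  by move=> y; apply: stays_N.
have xr : N x <= r.
  by apply: cK; apply: closureS cx => y; apply: stays_N.
apply/stays_consP; split=> //; apply: IH => B.
move=> /(f_continuous (a := a) (le_trans xr rr0))/cx[y [/stays_consP[_ yw] yB]].
by exists (f a y).
Qed.

(** A factor which is the identity near [u x] is the identity near all
    neighbouring points, so being nowhere the identity passes to the limit. *)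
Lemma itinerary_closed r w : r <= r0 -> closed (itinerary r w).
Proof.
move=> rr0 x cx; have sx : stays r w x.
  by apply: stays_closed => //; apply: closureS cx => y [].
split=> // u v t wE v0 idv.
have cu : {for x, continuous (act u)}.
  apply: (stays_continuous rr0); apply: (@stays_catl r u (v ++ t)).
  by rewrite -wE.
have /cu/cx[y [[_ yw] idy]] : \forall q \near act u x, id_near v q.
  exact: nbhs_interior idv.
exact: yw u v t wE v0 idy.
Qed.

Lemma itinerary_compact r w : r <= r0 -> compact (itinerary r w).
Proof.
move=> rr0; apply: subclosed_compact (itinerary_closed (w := w) rr0) N_compact _.
by move=> x [/stays_N /le_trans xr _]; exact: xr.
Qed.

Lemma not_fixed_near w x : {for x, continuous (act w)} -> act w x <> x ->
  \forall y \near x, act w y <> y.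
Proof.
move=> cw wx; move: T_hausdorff; rewrite open_hausdorff => /(_ x (act w x)).
have xw : x != act w x by apply/eqP => /esym.
move=> /(_ xw)[[U W]] /= [/set_mem Ux /set_mem Ww] [oU oW UW].
have nW := near_preimage cw (open_nbhs_nbhs (conj oW Ww)).
have nU : nbhs x U by exact: open_nbhs_nbhs.
apply: filterS2 nU nW => y Uy /= Wy yE.
have : (U `&` W) y by split=> //; rewrite -yE.
by rewrite (eqP UW).
Qed.

(** ** Itineraries reach the boundary *)

(** The form that the dichotomy on fixed points takes inside the ball N <= r0. *)
Hypothesis fixed_isolated : forall v p, stays r0 v p -> act v p = p ->
  ~ id_near v p ->
  exists2 W, nbhs p W & forall q, W q -> stays r0 v q -> act v q = q -> q = p.

(** Points where [v] is locally the identity cannot accumulate at a point where it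
    is not: that point would be a fixed point of [v], hence an isolated one. *)
Lemma not_id_near_open u v t x : stays r0 (u ++ v ++ t) x ->
  ~ id_near v (act u x) ->
  \forall y \near x, stays r0 (u ++ v ++ t) y -> ~ id_near v (act u y).
Proof.
move=> sx nid; have cu := stays_continuous (lexx r0) (stays_catl sx).
have sv : stays r0 v (act u x) by apply: stays_catl; exact: stays_catr sx.
have [vp|vp] := pselect (act v (act u x) = act u x); last first.
  have := near_preimage cu (not_fixed_near (stays_continuous (lexx r0) sv) vp).
  by apply: filterS => y yv _ idy; apply: yv; exact: (nbhs_singleton idy).
have [W pW Wp] := fixed_isolated sv vp nid.
apply: filterS (near_preimage cu pW) => y /= Wy sy idy.
apply: nid; rewrite -(Wp _ Wy) //; last exact: nbhs_singleton idy.
by apply: stays_catl; exact: stays_catr sy.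
Qed.

Lemma near_stays r w x : r <= r0 ->
  (forall u t, w = u ++ t -> N (act u x) < r) ->
  \forall y \near x, stays r w y.
Proof.
move=> rr0; elim: w x => [|a w IH] x xw.
all: have xr : \forall y \near x, N y < r
  by apply: (cvgr_lt _ (N_continuous (x:=x))); exact: (xw [::] _ erefl).
  by apply: filterS xr => y yr [|//] [|//] _; exact: ltW.
have xr0 : N x <= r0 by rewrite (le_trans _ rr0) // ltW // (nbhs_singleton xr).
have sw : \forall z \near f a x, stays r w z.
  by apply: IH => u t wE; apply: (xw (a :: u) t); rewrite wE.
apply: filterS2 xr (near_preimage (f_continuous (a := a) xr0) sw) => y /ltW yr sy; exact/stays_consP.
Qed.

Lemma near_never_id w x : itinerary r0 w x ->
  \forall y \near x, stays r0 w y -> never_id w y.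
Proof.
move=> [sx nx].
suff : \forall y \near x, forall ij : 'I_(size w).+1 * 'I_(size w).+1,
  stays r0 w y -> take ij.2 (drop ij.1 w) <> [::] ->
  ~ id_near (take ij.2 (drop ij.1 w)) (act (take ij.1 w) y).
  apply: filterS => y yw sy u v t; move: u v t.
  apply: (@factorization_ind (fun u v => v <> [::] -> ~ id_near v (act u y))) => i j.
  exact: (yw (i, j)).
apply: filter_forall => -[i j] /=.
set u := take i w; set v := take j _; pose t := drop j (drop i w).
have wE : w = u ++ v ++ t by rewrite !cat_take_drop.
have [v0|v0] := pselect (v = [::]); first by apply: nearW => y _ /(_ v0).
rewrite wE in sx; have := not_id_near_open sx (nx _ _ _ wE v0).
by apply: filterS => y yw sy _; apply: yw; rewrite -wE.
Qed.

Variable o : T.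
Hypothesis f_fix : forall a, f a o = o.
Hypothesis N_o : N o = 0.
Hypothesis no_clopen : forall B : set T, compact B -> open B -> B = set0.

Lemma act_fix w : act w o = o.
Proof. by elim: w => //= a w; rewrite f_fix. Qed.

(** If the itineraries from this compact set stayed strictly inside the ball, it
    would also be open; but it contains the base point. *)
Lemma itinerary_boundary r w : 0 < r -> r <= r0 -> never_id w o ->
  exists u t x, [/\ w = u ++ t, itinerary r w x & N (act u x) = r].
Proof.
move=> r_gt0 rr0 w0; apply: contrapT => nb.
have B0 : itinerary r w o.
  by split=> // u t _; rewrite act_fix N_o ltW.
suff oB : open (itinerary r w).
  have BE := no_clopen (itinerary_compact (w := w) rr0) oB.
  by rewrite BE in B0.
rewrite openE => x [sx nx].
have : \forall y \near x, stays r w y.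
  apply: near_stays => // u t wE; rewrite lt_neqAle (sx _ _ wE) andbT.
  by apply/eqP => ur; apply: nb; exists u, t, x.
have := near_never_id (conj (stays_le rr0 sx) nx).
apply: filterS2 => y yn ys; split=> //; apply: yn; exact: stays_le ys.
Qed.

(** The point of the sphere may be anywhere on the itinerary, because a word may contract everything: its
    itinerary then meets the sphere only at the start, and that of the inverse
    word only at the end. *)
Definition sphere_itinerary (r : R) (m : nat) : set T :=
  [set y | N y = r /\
    exists u t x, [/\ size (u ++ t) = m, itinerary r (u ++ t) x & y = act u x]].

(** One letter can be dropped on either side of the point of the sphere: the last
    one if there is a letter after that point, the first one otherwise. *)
Lemma sphere_itinerary_decr r m :
  sphere_itinerary r m.+1 `<=` sphere_itinerary r m.
Proof.
move=> y [yr [u [t [x [sz xw yE]]]]]; split=> //.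
case/lastP: t => [|t a] in sz xw *.
  case: u sz xw yE => //= a u [sz] xw yE; exists u, [::], (f a x); split=> //.
  exact: (@itinerary_catr _ [:: a]).
exists u, t, x; split=> //; last by apply: (@itinerary_catl _ _ [:: a]); rewrite -catA cats1.
by move: sz; rewrite !size_cat size_rcons addnS => -[].
Qed.

Lemma sphere_itinerary_anti r m j : (m <= j)%N ->
  sphere_itinerary r j `<=` sphere_itinerary r m.
Proof.
elim: j => [|j IH]; first by rewrite leqn0 => /eqP ->.
rewrite leq_eqVlt => /orP[/eqP <- //|/IH jm y].
by move=> /sphere_itinerary_decr/jm.
Qed.

Lemma sphere_itinerary_closed r m : r <= r0 -> closed (sphere_itinerary r m).
Proof.
move=> rr0.
have cS : closed [set y | N y = r].
  apply: (@preimage_closed _ _ N [set y | y = r]); last exact: closed_eq.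
  by move=> x _; exact: N_continuous.
have cI (w u : seq A) t : w = u ++ t -> closed (act u @` itinerary r w).
  move=> wE; apply: (compact_closed T_hausdorff).
  apply: continuous_compact; last exact: itinerary_compact.
  apply: continuous_in_subspaceT => x /set_mem[sx _].
  by apply: (stays_continuous rr0); apply: (@stays_catl r u t); rewrite -wE.
have -> : sphere_itinerary r m = [set y | N y = r] `&`
   \bigcup_(p in [set: m.-tuple A * 'I_m.+1])
     (act (take p.2 p.1) @` itinerary r p.1).
  apply/seteqP; split=> [y [yr [u [t [x [sz xw yE]]]]]|y [yr [[w i] _ [x xw yE]]]].
    have um : (size u < m.+1)%N by rewrite -sz size_cat ltnS leq_addr.
    split=> //; rewrite yE.
    have wm : size (u ++ t) == m by exact/eqP.
    exists (Tuple wm, Ordinal um) => //=; exists x => //.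
    by rewrite take_size_cat.
  split=> //.
  exists (take i w), (drop i w), x.
  by rewrite cat_take_drop size_tuple.
apply: closedI => //; apply: closed_bigcup; first exact: finite_finset.
by move=> [w i] _; apply: (cI _ _ (drop i w)); rewrite cat_take_drop.
Qed.

(** ** Finite orbits force isolated cycles *)

Variable finv : A -> A.
Hypothesis finvK : forall a x, N x <= r0 -> f (finv a) (f a x) = x.

Lemma act_rev u x : stays r0 u x -> act (rev (map finv u)) (act u x) = x.
Proof.
elim: u x => //= a u IH x /stays_consP[xr xu].
by rewrite rev_cons -cats1 act_cat IH //= finvK.
Qed.

Lemma stays_rcons r w a x :
  stays r w x -> N (act (rcons w a) x) <= r -> stays r (rcons w a) x.
Proof.
move=> xw wa u t; case/lastP: t => [|t b]; first by rewrite cats0 => <-.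
by rewrite -rcons_cat => /rcons_inj[/xw].
Qed.

Lemma stays_rev u x : stays r0 u x -> stays r0 (rev (map finv u)) (act u x).
Proof.
elim: u x => //= a u IH x /stays_consP[xr xu].
rewrite rev_cons; apply: stays_rcons; first exact: IH.
by rewrite -cats1 act_cat (act_rev xu) /= finvK.
Qed.

Definition local_orbit (y : T) : set T :=
  [set z | exists2 u, stays r0 u y & z = act u y].

(** A nonempty [v] is a factor of itself, so it is not the identity near these
    fixed points, which are therefore isolated from each other. *)
Definition isolated_cycles (v : seq A) : set T :=
  itinerary r0 v `&` [set p | act v p = p].

(** A compact set all of whose points are isolated is finite. *)
Lemma isolated_cycles_finite v : v <> [::] -> finite_set (isolated_cycles v).
Proof.
move=> v0.
have cF : compact (isolated_cycles v).
  apply: subclosed_compact (itinerary_compact (w := v) (lexx r0)) _; last by move=> p [].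
  move=> p cp; have ip : itinerary r0 v p.
    by apply: itinerary_closed => //; apply: closureS cp => q [].
  split=> //; apply: contrapT => vp.
  have [q [[_ vq] /(_ vq)]] := cp _ (not_fixed_near (stays_continuous (lexx r0) ip.1) vp).
  by [].
have iF p : isolated_cycles v p ->
    exists2 W, nbhs p W & forall q, W q -> isolated_cycles v q -> q = p.
  move=> [[sp np] vp]; have nid : ~ id_near v p.
    by apply: (np [::] v [::]); rewrite ?cats0.
  have [W pW Wp] := fixed_isolated sp vp nid.
  by exists W => // q Wq [[sq _] vq]; exact: Wp.
(* The largest open set that meets the isolated cycles at most in p. *)
pose U p := ~` closure (isolated_cycles v `\ p).
have UI p q : U p q -> isolated_cycles v q -> q = p.
  by move=> Uq vq; apply: contrapT => qp; apply: Uq; apply: subset_closure.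
move: cF; rewrite compact_cover => /(_ T (isolated_cycles v) U)[p _||D _ DU].
- exact/closed_openC/closed_closure.
- move=> p pv; exists p => // /(_ _)cp.
  have [W /cp[q [[qv qp] Wq]] Wp] := iF p pv.
  by apply: qp; exact: Wp.
- apply: sub_finite_set (finite_fset D) => q qv.
  by have [p pD Uq] := DU q qv; rewrite (UI p q Uq qv).
Qed.

Definition cycle_points : set T :=
  [set y | exists v u p, [/\ v <> [::], isolated_cycles v p & y = act u p]].

Lemma cycle_points_countable : countable cycle_points.
Proof.
have -> : cycle_points = \bigcup_(vu in [set vu : seq A * seq A | vu.1 <> [::]])
   (act vu.2 @` isolated_cycles vu.1).
  apply/seteqP; split=> [y [v [u [p [v0 pv ->]]]]|y [[v u] /= v0 [p pv <-]]].
    by exists (v, u) => //; exists p.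
  by exists v, u, p.
apply: bigcup_countable => [|[v u] /= v0]; first exact: countableP.
exact/finite_set_countable/finite_image/isolated_cycles_finite.
Qed.

Hypothesis N_orbits : forall y, N y <= r0 -> finite_set (local_orbit y).

(** By compactness one point of the sphere lies on itineraries of all lengths.
    Its orbit contains these itineraries, since letters are invertible; an
    itinerary longer than the orbit is large revisits a point, which is then
    fixed by the factor of the word read in between. *)
Lemma sphere_cycle_point r : r <= r0 ->
  (forall m, sphere_itinerary r m !=set0) ->
  exists2 y, cycle_points y & N y = r.
Proof.
move=> rr0 S0.
(* A cluster point of arbitrary z m in the nested closed sets. *)
have [y Sy] : exists y, forall m, sphere_itinerary r m y.
  pose K := [set x | N x <= r0].
  pose z m := sval (cid (S0 m)).
  have zS m : sphere_itinerary r m (z m) by exact: svalP (cid (S0 m)).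
  have zK : (z @ \oo) K by exists 0%N => // m _; rewrite /= /K /= (zS m).1.
  have [y [_ yz]] := N_compact (fmap_proper_filter z _) zK.
  exists y => m; apply: (sphere_itinerary_closed (m := m) rr0) => B.
  apply: yz; exists m => // j /= mj; exact: sphere_itinerary_anti (zS j).
have yr : N y = r by have [] := Sy 0.
exists y => //.
have /finite_seqP[s sE] : finite_set (local_orbit y) by apply: N_orbits; rewrite yr.
have [_ [u [t [x [sz [sx nx] yE]]]]] := Sy (size s).
have sx0 := stays_le rr0 sx.
set w := u ++ t in sz sx nx sx0.
(* Before y the itinerary is read backwards from y, after y forwards. *)
have iters i : act (take i w) x \in s.
  suff : local_orbit y (act (take i w) x) by rewrite sE.
  rewrite /w take_cat; case: ltnP => _.
    have yE' : y = act (drop i u) (act (take i u) x) by rewrite -act_cat cat_take_drop.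
    exists (rev (map finv (drop i u))); rewrite yE'.
      by apply: stays_rev; apply: stays_catr; rewrite cat_take_drop; exact: stays_catl sx0.
    rewrite act_rev //; apply: stays_catr; rewrite cat_take_drop; exact: stays_catl sx0.
  exists (take (i - size u) t); rewrite yE ?act_cat //.
  apply: (@stays_catl _ _ (drop (i - size u) t)); rewrite cat_take_drop.
  exact: stays_catr.
have : ~~ uniq [seq act (take i w) x | i <- iota 0 (size s).+1].
  apply/negP => us; have := uniq_leq_size (s2 := s) us.
  rewrite size_map size_iota ltnn => h; suff: false by []; apply: h.
  by move=> _ /mapP[i _ ->].
move=> /(uniqPn x)[i [j [ij]]]; rewrite size_map size_iota ltnS => js.
have isz := leq_ltn_trans (ltnW ij) (_ : j < (size s).+1)%N.
rewrite !(nth_map 0%N) ?size_iota ?isz // !nth_iota ?isz // !add0n => pE.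
pose v := take (j - i) (drop i w).
have wE : w = take i w ++ v ++ drop (j - i) (drop i w) by rewrite !cat_take_drop.
have tj : take j w = take i w ++ v.
  by rewrite -takeD subnKC // ltnW.
exists v, (rev (map finv (take i w)) ++ u), (act (take i w) x).
have sp : stays r0 (take i w) x by apply: (@stays_catl _ _ (drop i w)); rewrite cat_take_drop.
split; last by rewrite act_cat act_rev.
- move=> /(congr1 size)/eqP; rewrite size_takel ?size_drop ?sz ?leq_sub2r //.
  by rewrite subn_eq0 leqNgt ij.
- split; last by rewrite /= -act_cat -tj.
  have iw : itinerary r0 (take i w ++ v ++ drop (j - i) (drop i w)) x.
    by rewrite -wE.
  exact/itinerary_catl/(itinerary_catr iw).
Qed.

Lemma sphere_itinerary_neq0 r m : 0 < r -> r <= r0 ->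
  (exists2 w, size w = m & never_id w o) -> sphere_itinerary r m !=set0.
Proof.
move=> r_gt0 rr0 [w sw w0].
have [u [t [x [wE xw xr]]]] := itinerary_boundary r_gt0 rr0 w0.
by exists (act u x); split=> //; exists u, t, x; rewrite -wE.
Qed.

Hypothesis r0_gt0 : 0 < r0.

(** Otherwise every r in ]0, r0] would be the value of N at some point of the
    countable set [cycle_points]. *)
Lemma never_id_bounded : exists m, forall w, size w = m -> ~ never_id w o.
Proof.
apply: contrapT => nm.
have long m : exists2 w, size w = m & never_id w o.
  apply: contrapT => nw; apply: nm; exists m => w sw w0.
  by apply: nw; exists w.
have : lebesgue_measure (`]0, r0]%classic : set R) = 0%E.
  apply: countable_lebesgue_measure0.
  apply: sub_countable (cycle_points_countable).
  apply: card_le_trans (card_image_le N cycle_points).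
  apply: subset_card_le => r /=; rewrite in_itv /= => /andP[r_gt0 rr0].
  have [|y cy yr] := sphere_cycle_point rr0; last by exists y.
  by move=> m; exact: sphere_itinerary_neq0.
rewrite lebesgue_measure_itv /= lte_fin r0_gt0 => /eqP.
by rewrite -EFinD subr0 eqe gt_eqF.
Qed.

End Exhaustion.

(** ** Words and germs *)

Section Germs.
Variable o : T.
Hypothesis f_fix : forall a, f a o = o.
Hypothesis f_cont0 : forall a, {for o, continuous (f a)}.

Definition germ_at (g : T -> T) : set (T -> T) :=
  [set g' | \forall x \near o, g' x = g x].

Lemma eq_germ_at g g' : (\forall x \near o, g x = g' x) -> germ_at g = germ_at g'.
Proof.
move=> gg'; apply/seteqP; split=> e /= ee.
  by apply: filterS2 gg' ee => x <-.
by apply: filterS2 gg' ee => x ->.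
Qed.

Lemma act_continuous_base w : {for o, continuous (act w)}.
Proof.
elim: w => [|a w IH]; first exact: cvg_id.
have cw : {for f a o, continuous (act w)} by rewrite f_fix.
exact: (continuous_comp (@f_cont0 a) cw).
Qed.

(** Deleting a factor with trivial germ shortens a word without changing its germ,
    so every germ is represented by a word of length at most [m]. *)
Lemma germ_group_finite m : (forall w, size w = m -> ~ never_id w o) ->
  finite_set (range (fun w => germ_at (act w))).
Proof.
move=> nm.
suff short w : exists w' : m.-bseq A, germ_at (act w) = germ_at (act w').
  apply: sub_finite_set (finite_image (fun w : m.-bseq A => germ_at (act w))
    (@finite_finset _ setT)) => _ [w _ <-].
  by have [w' ->] := short w; exists w'.
have [l] := ubnP (size w); elim: l w => // l IH w; rewrite ltnS => wl.
have [wm|wm] := leqP (size w) m; first by exists (Bseq wm).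
have [u [v [t [wE v0 idv]]]] : exists u v t,
    [/\ w = u ++ v ++ t, v <> [::] & id_near v (act u o)].
  apply: contrapT => nu; apply: (nm (take m w)); first by rewrite size_takel // ltnW.
  move=> u v t wE v0 idv; apply: nu; exists u, v, (t ++ drop m w); split=> //.
  by rewrite -[LHS](cat_take_drop m) wE -!catA.
have [|w' w'E] := IH (u ++ t).
  apply: leq_trans wl; rewrite wE !size_cat ltn_add2l -[ltnLHS]add0n ltn_add2r.
  by case: (v) v0.
exists w'; rewrite -w'E; apply: eq_germ_at.
have idu : \forall x \near o, act v (act u x) = act u x.
  exact: near_preimage (act_continuous_base (w := u)) idv.
apply: filterS idu => x vx.
by rewrite wE !act_cat vx.
Qed.

Lemma germ_atP w w' : germ_at (act w) = germ_at (act w') ->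
  \forall x \near o, act w x = act w' x.
Proof.
move=> ww'; suff : germ_at (act w') (act w) by [].
by rewrite -ww'; exact: nearW.
Qed.

(** Finitely many words represent all germs, and following one of them by a letter
    gives, on a common neighbourhood, the same map as another one.  By induction
    every word moves a point of this neighbourhood as one of them does. *)
Lemma finite_local_orbits : finite_set (range (fun w => germ_at (act w))) ->
  \forall x \near o, finite_set (range (fun w => act w x)).
Proof.
set G := range _ => Gfin.
have /boolp.choice[rep repE] e : exists w, G e -> germ_at (act w) = e.
  have [[w _ wE]|nG] := pselect (G e); first by exists w.
  by exists [::].
have /finite_seqP[ws wsE] : finite_set (rep @` G) by exact: finite_image.
have repw w : exists2 w', w' \in ws & \forall x \near o, act w x = act w' x.
  have Gw : G (germ_at (act w)) by exists w.
  exists (rep (germ_at (act w))); last by apply: germ_atP; rewrite repE.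
  by have : (rep @` G) (rep (germ_at (act w))) by [exists (germ_at (act w))]; rewrite wsE.
have [w0 w0s near0] := repw [::].
have : \forall x \near o, forall ia : 'I_(size ws) * A,
    exists2 w', w' \in ws & f ia.2 (act (nth [::] ws ia.1) x) = act w' x.
  apply: filter_forall => -[i a].
  have [w' w's] := repw (nth [::] ws i ++ [:: a]).
  by apply: filterS => x xw; exists w' => //; rewrite -xw act_cat.
apply: filterS2 near0 => x x0 xs.
apply: sub_finite_set (finite_image (fun w => act w x) (finite_seq ws)) => _ [w _ <-].
elim/last_ind: w => [|w a [w' /= w's w'E]]; first by exists w0.
have iw' : (index w' ws < size ws)%N by rewrite index_mem.
have [w'' w''s xE] := xs (Ordinal iw', a).
by exists w'' => //; rewrite -xE -cats1 act_cat /= nth_index // w'E.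
Qed.

End Germs.
End Words.

(** * The pseudogroup on C^n *)

Section Letters.
Set Implicit Arguments.
Unset Strict Implicit.
Context {R : realType} {n k : nat} (h : 'I_k -> local_diffeo R n).
Context (V : set (Cn R n)).
Hypothesis hV : pseudogroup_domain h V.

Lemma letter_map_continuous a x : V x -> {for x, continuous (letter_map h a)}.
Proof.
have [_ _ sub] := hV; case: a => i b /(sub i)[dx ix].
rewrite /letter_map /=; case: b.
  by apply: differentiable_continuous; apply: (ld_inv_holo (h i)).2.
by apply: differentiable_continuous; apply: (ld_fun_holo (h i)).2.
Qed.

Definition letter_inv (a : letter k) : letter k := (a.1, ~~ a.2).

Lemma letter_mapK a x : V x -> letter_map h (letter_inv a) (letter_map h a x) = x.
Proof.
have [_ _ sub] := hV; case: a => i [] /(sub i)[dx [z zd zx]].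
  by rewrite /letter_map /= -zx ld_funK.
by rewrite /letter_map /= ld_funK.
Qed.

Lemma letter_map0 a : letter_map h a 0 = 0.
Proof.
case: a => i []; rewrite /letter_map /= ?ld_fun0 //.
by rewrite -{1}(ld_fun0 (h i)) ld_funK //; exact: ld_dom0.
Qed.

Lemma stays_Dom (U : set (Cn R n)) r w :
  [set x : Cn R n | cnorm x <= r] `<=` U ->
  stays (letter_map h) cnorm r w `<=` Dom h U w.
Proof.
move=> rV x xw; split; first exact/rV/(stays_N xw).
by move=> l _; apply/rV/(xw _ (drop l w)); rewrite cat_take_drop.
Qed.

Lemma finite_orbits_of_finite_germ_group :
  finite_set (germ_group h) -> has_finite_orbits h.
Proof.
have [oV V0 sub] := hV => Gfin.
have nU : \forall x \near (0 : Cn R n), finite_set (range (fun w => word_map h w x)).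
  exact: finite_local_orbits Gfin.
exists (V `&` [set x | finite_set (range (fun w => word_map h w x))]°); split.
  split=> [||i x [/sub]//]; first exact/openI/open_interior.
  by split.
move=> p [_ /interior_subset pfin]; apply: sub_finite_set pfin.
by move=> q [_ [w _ ->]]; exists w.
Qed.

Lemma finite_germ_group_of_finite_orbits : (0 < n)%N ->
  (forall (g : word k) (p : Cn R n), Dom h V g p -> word_map h g p = p ->
      isolated (fixed_points h V g) p \/
      (\forall x \near p, Dom h V g x /\ word_map h g x = x)) ->
  has_finite_orbits h -> finite_set (germ_group h).
Proof.
move=> n_gt0 hfix [V' [[oV' V'0 _] V'fin]]; have [oV V0 _] := hV.
have [r r_gt0 rVV] : exists2 r : R, 0 < r &
    [set x : Cn R n | cnorm x <= r] `<=` V `&` V'.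
  by apply/nbhs0_cball/open_nbhs_nbhs; split=> //; exact: openI.
have rV : [set x : Cn R n | cnorm x <= r] `<=` V by move=> x /rVV[].
have rV' : [set x : Cn R n | cnorm x <= r] `<=` V' by move=> x /rVV[].
have [m nm] : exists m, forall w, size w = m ->
    ~ never_id (letter_map h) w (0 : Cn R n).
  have T_hausdorff : hausdorff_space (Cn R n) by exact: norm_hausdorff.
  have f_continuous a x : cnorm x <= r -> {for x, continuous (letter_map h a)}.
    by move=> /rV; exact: letter_map_continuous.
  have finvK a x : cnorm x <= r ->
      letter_map h (letter_inv a) (letter_map h a x) = x.
    by move=> /rV; exact: letter_mapK.
  apply: (never_id_bounded T_hausdorff cnorm_continuous (cball_compact r)
    f_continuous _ letter_map0 cnorm0 _ finvK _ r_gt0).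
  - move=> v p sp vp nid.
    have [[_ [W pW WE]]|idp] := hfix v p (stays_Dom rV sp) vp.
      exists W => // q Wq sq vq; have : (W `&` fixed_points h V v) q.
        by split=> //; split=> //; exact: (stays_Dom rV sq).
      by rewrite WE.
    by exfalso; apply: nid; apply: filterS idp => q [].
  - by move=> B; exact: compact_not_open.
  - move=> y yr; apply: sub_finite_set (V'fin y (rV' _ yr)) => z [u su ->].
    split; first by apply/rV'/(su _ [::]); rewrite cats0.
    by exists u => //; exact: (stays_Dom rV' su).
apply: (germ_group_finite letter_map0 _ nm) => a.
exact: letter_map_continuous.
Qed.

End Letters.

Theorem theoremA (R : realType) (n k : nat) (n_ge1 : (1 <= n)%N)
    (h : 'I_k -> local_diffeo R n) (V : set (Cn R n))
    (hV : pseudogroup_domain h V)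
    (hfix : forall (g : word k) (p : Cn R n),
      Dom h V g p -> word_map h g p = p ->
      isolated (fixed_points h V g) p \/
      (\forall x \near p, Dom h V g x /\ word_map h g x = x)) :
  has_finite_orbits h <-> finite_set (germ_group h).
Proof.
split; first exact: finite_germ_group_of_finite_orbits hfix.
exact: finite_orbits_of_finite_germ_group hV.
Qed.
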